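(* For every $n\ge 1$ there is a bijection $\phi$ between the set $\mathcal{DU}_{2n}(4123)$ and the set of Yamanouchi words on the alphabet $\{1,2,3\}$ of type $(n,n,n)$ such that, for every $\pi=\pi_1\pi_2\ldots\pi_{2n}\in\mathcal{DU}_{2n}(4123)$, one has $\pi_1=\alpha(\phi(\pi))$ and $\mathcal{A}(\pi)=\mathcal{B}(\phi(\pi))$.
   Context: A permutation $\pi=\pi_1\cdots\pi_m$ of $[m]=\{1,\ldots,m\}$ is down-up alternating if $\pi_1>\pi_2<\pi_3>\pi_4<\cdots$; it avoids the pattern $4123$ if no subsequence $\pi_{i_1}\pi_{i_2}\pi_{i_3}\pi_{i_4}$ ($i_1<i_2<i_3<i_4$) satisfies $\pi_{i_2}<\pi_{i_3}<\pi_{i_4}<\pi_{i_1}$. $\mathcal{DU}_m(4123)$ is the set of $4123$-avoiding down-up alternating permutations of $[m]$. A word $w$ on $\{1,2,\ldots\}$ has type $(c_1,c_2,c_3,\ldots)$ if $c_i$ letters equal $i$. A Yamanouchi word on $\{1,2,3\}$ of type $(n,n,n)$ is a word $w$ of that type such that every prefix of $w$ contains at least as many $1$'s as $2$'s and at least as many $2$'s as $3$'s (equivalently, $w=\chi(T)$ for a standard Young tableau $T$ of shape $(n,n,n)$, where the $j$-th letter of $\chi(T)$ is the row index of the entry $j$ in $T$). For a word $w=w_1\cdots w_N$ on $\{1,2,3\}$ containing a $3$, $\alpha(w)$ is the length of the initial run, i.e. $\alpha(w)=j$ where $w_{j+1}$ is the leftmost letter of $w$ equal to $3$. Define $\mathcal{A}(\pi)=\{0\}\cup\{k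 : \exists\, i<j \text{ with } \pi_i=k,\ \pi_j=k+1,\ k\le\pi_1-2\}$ for a permutation $\pi$, and $\mathcal{B}(w)=\{0\}\cup\{k : w_kw_{k+1}=12 \text{ and } k\le\alpha(w)-2\}$ for a word $w$. *)

(* Defs.v *)
From mathcomp Require Import all_boot.
From mathcomp Require Import classical_sets functions.

Set Implicit Arguments.
Unset Strict Implicit.
Unset Printing Implicit Defensive.

Local Open Scope classical_set_scope.

(* Words and permutations in one-line notation are sequences of positive
   integers; letters are numbered from 1, so [letter s i] is meaningful only
   for 1 <= i <= size s. *)
Definition letter (s : seq nat) (i : nat) : nat := nth 0 s i.-1.

Definition is_permutation (m : nat) (p : seq nat) : Prop :=
  perm_eq p (iota 1 m).

Definition down_up (p : seq nat) : Prop :=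
  forall i : nat, 1 <= i -> i < size p ->
    if odd i then letter p i.+1 < letter p i
             else letter p i < letter p i.+1.

Definition avoids4123 (p : seq nat) : Prop :=
  ~ exists i1 i2 i3 i4 : nat,
      [/\ 1 <= i1, i1 < i2, i2 < i3, i3 < i4 & i4 <= size p] /\
      [/\ letter p i2 < letter p i3, letter p i3 < letter p i4
        & letter p i4 < letter p i1].

Definition DU4123 (m : nat) : set (seq nat) :=
  [set p | [/\ is_permutation m p, down_up p & avoids4123 p]].

(* [c] lists the multiplicities c_1, c_2, ...; missing entries are 0. *)
Definition has_type (c : seq nat) (w : seq nat) : Prop :=
  forall i : nat, 1 <= i -> count_mem i w = letter c i.

Definition yamanouchi3 (n : nat) : set (seq nat) :=
  [set w | [/\ {subset w <= [:: 1; 2; 3]},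
               has_type [:: n; n; n] w
             & forall u : seq nat, prefix u w ->
                 count_mem 2 u <= count_mem 1 u /\
                 count_mem 3 u <= count_mem 2 u]].

(* [index] counts from 0, so this is the number of letters preceding the
   leftmost 3. *)
Definition alpha (w : seq nat) : nat := index 3 w.

(* In both sets below, k <= x - 2 is a comparison of integers and is written
   k + 2 <= x to avoid truncated subtraction. *)
Definition setA (p : seq nat) : set nat :=
  [set 0] `|`
  [set k | (exists i j : nat,
              [/\ 1 <= i, i < j, j <= size p,
                  letter p i = k & letter p j = k.+1])
           /\ k + 2 <= letter p 1].

Definition setB (w : seq nat) : set nat :=
  [set 0] `|`
  [set k | [/\ 1 <= k < size w, letter w k = 1, letter w k.+1 = 2
             & k + 2 <= alpha w]].

(* Main.v *)
(** Both families are grown from size n to size n+1 by the same rule.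
    A permutation is extended by prepending two new values a > b; a word is
    extended by inserting 12 at positions b, b+1 and then a 3 at position a+1,
    which becomes the leftmost 3.  If x and S stand for the statistics
    (pi_1, A(pi)), respectively (alpha(w), B(w)), the pair (a, b) is legal
    exactly when 1 <= b < a <= x + 2, b <= x and S has no element in
    [b, a - 3]; the new statistics are then a and
    {0} u {k in S : k <= b - 2} u {b if b <= a - 2}.  Every object of size
    n+1 >= 2 comes from a unique legal extension, so the bijection is built by
    induction on n from 21 <-> 123. *)
Require Import Defs.
From mathcomp Require Import all_boot.
From mathcomp Require Import boolp classical_sets functions.
From mathcomp Require Import zify.

Set Implicit Arguments.
Unset Strict Implicit.
Unset Printing Implicit Defensive.

(** * The growth rule, and insertion and deletion in words *)

Definition admissible (x : nat) (S : set nat) (a b : nat) : Prop :=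
  [/\ 1 <= b, b < a, a <= x + 2, b <= x
    & forall k, b <= k -> k + 3 <= a -> ~ S k].

(* Only the positive elements of the new statistic; 0 always belongs to it. *)
Definition next_set (S : set nat) (a b k : nat) : Prop :=
  (S k /\ k + 2 <= b) \/ (k = b /\ b + 2 <= a).

(** The new 3 has [a] letters before it, two of which are the inserted 12; hence it splits [w] after
    [a - 2] letters. *)
Definition insert123 (w : seq nat) (a b : nat) : seq nat :=
  take b.-1 w ++ [:: 1; 2] ++ drop b.-1 (take (a - 2) w) ++ 3 :: drop (a - 2) w.

Definition delete123 (w : seq nat) (a b : nat) : seq nat :=
  take b.-1 w ++ drop b.+1 (take a w) ++ drop a.+1 w.

Lemma nth_insert123 w a b k : 1 <= b -> b < a -> a <= size w + 2 ->
  nth 0 (insert123 w a b) k =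
  if k < b.-1 then nth 0 w k else if k == b.-1 then 1 else if k == b then 2
  else if k < a then nth 0 w (k - 2) else if k == a then 3
  else nth 0 w (k - 3).
Proof.
move=> b0 ba aw; rewrite /insert123 !nth_cat size_drop !size_takel; try lia.
case: ifP => [kb|kb]; first by rewrite nth_take.
case: eqP => [->|kb1]; first by rewrite subnn.
case: eqP => [->|kb2]; first by rewrite (_ : b - b.-1 = 1) //; lia.
rewrite /= ifF; last by lia.
case: ifP => ka.
  rewrite ifT; last by lia.
  rewrite nth_drop nth_take; last by lia.
  by congr nth; lia.
rewrite ifF; last by lia.
case: eqP => [->|ka1].
  by rewrite (_ : _ - _ - _ - _ = 0) //; lia.
rewrite (_ : k - b.-1 - 2 - (a - 2 - b.-1) = (k - a.+1).+1) /=; last by lia.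
by rewrite nth_drop; congr nth; lia.
Qed.

Lemma nth_delete123 w a b k : 1 <= b -> b < a -> a < size w ->
  nth 0 (delete123 w a b) k =
  if k < b.-1 then nth 0 w k else if k < a - 2 then nth 0 w (k + 2)
  else nth 0 w (k + 3).
Proof.
move=> b0 ba aw; rewrite /delete123 !nth_cat size_drop !size_takel; try lia.
case: ifP => [kb|kb]; first by rewrite nth_take.
rewrite (_ : (k - b.-1 < a - b.+1) = (k < a - 2)); last by lia.
case: ifP => ka; rewrite !nth_drop ?nth_take; try lia; by congr nth; lia.
Qed.

Lemma size_insert123 w a b : 1 <= b -> b < a -> a <= size w + 2 ->
  size (insert123 w a b) = size w + 3.
Proof.
move=> b0 ba aw; rewrite /insert123 !size_cat /= !size_drop !size_takel; lia.
Qed.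

Lemma size_delete123 w a b : 1 <= b -> b < a -> a < size w ->
  size (delete123 w a b) = size w - 3.
Proof.
move=> b0 ba aw; rewrite /delete123 !size_cat /= !size_drop !size_takel; lia.
Qed.

Lemma insert123K w a b : 1 <= b -> b < a -> a <= size w + 2 ->
  delete123 (insert123 w a b) a b = w.
Proof.
move=> b0 ba aw; have sW := size_insert123 b0 ba aw.
apply: (@eq_from_nth _ 0).
  by rewrite size_delete123 ?sW //; lia.
move=> k _; rewrite nth_delete123 ?sW; try lia.
by rewrite !nth_insert123 //; repeat case: ifP => ?; try lia; congr nth; lia.
Qed.

Lemma delete123K w a b : 1 <= b -> b < a -> a < size w ->
  nth 0 w b.-1 = 1 -> nth 0 w b = 2 -> nth 0 w a = 3 ->
  insert123 (delete123 w a b) a b = w.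
Proof.
move=> b0 ba aw w1 w2 w3; have sW := size_delete123 b0 ba aw.
apply: (@eq_from_nth _ 0).
  by rewrite size_insert123 ?sW //; lia.
move=> k _; rewrite nth_insert123 ?sW; try lia.
rewrite !nth_delete123 //.
repeat case: ifP => ?; try lia; try (by congr nth; lia).
- by rewrite -w1; congr nth; lia.
- by rewrite -w2; congr nth; lia.
- by rewrite -w3; congr nth; lia.
Qed.

Lemma mem_delete123 w a b : {subset delete123 w a b <= w}.
Proof.
by move=> x; rewrite !mem_cat => /or3P[/mem_take|/mem_drop/mem_take|/mem_drop].
Qed.

(** * Letter counts in prefixes *)

Lemma count_take_succ c w i : 0 < c ->
  count_mem c (take i.+1 w) = count_mem c (take i w) + (nth 0 w i == c).
Proof.
move=> c0; case: (ltnP i (size w)) => iw.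
  by rewrite (take_nth 0 iw) -cats1 count_cat /= addn0.
rewrite nth_default // !take_oversize ?(leqW iw) //; lia.
Qed.

Lemma count_insert123 c w a b : 1 <= b -> b < a -> a <= size w + 2 ->
  count_mem c (insert123 w a b) =
  count_mem c w + (c == 1) + (c == 2) + (c == 3).
Proof.
move=> b0 ba aw; rewrite /insert123 !count_cat /=.
rewrite -{4}(cat_take_drop (a - 2) w) count_cat.
rewrite -{2}(cat_take_drop b.-1 (take (a - 2) w)) count_cat take_takel; last lia.
rewrite !(eq_sym c); lia.
Qed.

(** A prefix of the new word is a prefix of [w] enriched by the empty word, 1, 12 or 123, so the
    Yamanouchi inequalities can be compared prefix by prefix. *)
Lemma count_take_insert123 c w a b i : 0 < c ->
  1 <= b -> b < a -> a <= size w + 2 ->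
  count_mem c (take i (insert123 w a b)) =
  if i < b then count_mem c (take i w)
  else if i == b then count_mem c (take b.-1 w) + (c == 1)
  else if i <= a then count_mem c (take (i - 2) w) + (c == 1) + (c == 2)
  else count_mem c (take (i - 3) w) + (c == 1) + (c == 2) + (c == 3).
Proof.
move=> c0 b0 ba aw; elim: i => [|i IH]; first by rewrite !take0 b0.
rewrite count_take_succ // IH nth_insert123 // !(eq_sym c).
have S j : count_mem c (take j.+1 w) = _ := count_take_succ w j c0.
have [ib|ib] := ltnP i b.-1.
  by do 2 (rewrite ifT; last lia); rewrite S.
have [->|ib1] := eqVneq i b.-1.
  by rewrite prednK // ltnn eqxx ifT //; lia.
have [->|ib2] := eqVneq i b.
  rewrite ltnn (_ : (b.+1 < b) = false); last lia.
  rewrite (_ : (b.+1 == b) = false); last lia.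
  by rewrite ba (_ : b.+1 - 2 = b.-1) //; lia.
rewrite (_ : (i < b) = false); last lia.
rewrite (_ : (i.+1 < b) = false); last lia.
rewrite (_ : (i.+1 == b) = false); last lia.
have [ia|ia] := ltnP i a.
  rewrite (ltnW ia) (_ : i.+1 - 2 = (i - 2).+1) ?S; last lia.
  move: (count _ _) (nth _ _ _ == c) => x y; lia.
have [->|ia1] := eqVneq i a.
  by rewrite leqnn (_ : a.+1 - 3 = a - 2) //; lia.
rewrite (_ : (i <= a) = false); last lia.
rewrite (_ : i.+1 - 3 = (i - 3).+1) ?S; last lia.
move: (count _ _) (nth _ _ _ == c) => x y; lia.
Qed.

Lemma prefix_take (w : seq nat) i : prefix (take i w) w.
Proof. by rewrite -{2}(cat_take_drop i w) prefix_prefix. Qed.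

Lemma yamanouchi3E n w : yamanouchi3 n w <->
  [/\ {subset w <= [:: 1; 2; 3]},
      forall c, 0 < c -> count_mem c w = if c <= 3 then n else 0
    & forall i, count_mem 2 (take i w) <= count_mem 1 (take i w) /\
                count_mem 3 (take i w) <= count_mem 2 (take i w)].
Proof.
have E c : 0 < c -> letter [:: n; n; n] c = if c <= 3 then n else 0.
  by case: c => [|[|[|[|c]]]] //= _; rewrite /letter /= nth_nil.
split=> -[sw tw pw]; split=> //.
- by move=> c c0; rewrite tw ?E.
- by move=> i; apply: pw; apply: prefix_take.
- by move=> c c0; rewrite tw ?E.
- by move=> u; rewrite prefixE => /eqP <-; apply: pw.
Qed.

(** * The statistics on words, in zero-based positions *)

Lemma nth_lt_alpha w i : i < alpha w -> nth 0 w i != 3.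
Proof. by move/(before_find 0) => /= ->. Qed.

Lemma nth_alpha w : 0 < count_mem 3 w -> nth 0 w (alpha w) = 3.
Proof. by rewrite -has_count has_pred1; apply: nth_index. Qed.

Lemma alpha_le_size w : alpha w <= size w.
Proof. exact: index_size. Qed.

Lemma alpha_le w i : nth 0 w i = 3 -> alpha w <= i.
Proof.
by case: leqP => // /nth_lt_alpha /eqP.
Qed.

Lemma alpha_ge w a : 0 < count_mem 3 w ->
  (forall i, i < a -> nth 0 w i != 3) -> a <= alpha w.
Proof.
by move=> /nth_alpha w3 H; case: leqP => // /H; rewrite w3.
Qed.

Lemma alpha_eq w a : nth 0 w a = 3 -> (forall i, i < a -> nth 0 w i != 3) ->
  alpha w = a.
Proof.
move=> w3 H; apply/eqP; rewrite eqn_leq alpha_le //=; apply: alpha_ge => //.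
rewrite -has_count has_pred1 -w3 mem_nth //.
(* Past the end [nth] returns 0, which is not 3. *)
by case: ltnP => // aw; move: w3; rewrite nth_default.
Qed.

(** The bound [k < size w] is implied: the default value 0 is not the letter 2. *)
Lemma setBE w k : 0 < k -> setB w k <->
  [/\ nth 0 w k.-1 = 1, nth 0 w k = 2 & k + 2 <= alpha w].
Proof.
rewrite /setB /letter /= => k0; split.
  by case=> [/= k00|[/= _ ? ? ?]] //; rewrite k00 in k0.
case=> w1 w2 kw; right; split=> //=; rewrite k0 /=.
by case: ltnP => // kw'; rewrite nth_default in w2.
Qed.

(** * Effect of a legal insertion, and its injectivity *)

Section InsertWord.
Variables (w : seq nat) (a b : nat).
Hypothesis adm : admissible (alpha w) (setB w) a b.

Let b0 : 1 <= b. Proof. by case: adm. Qed.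
Let ba : b < a. Proof. by case: adm. Qed.
Let aw : a <= alpha w + 2. Proof. by case: adm. Qed.
Let bw : b <= alpha w. Proof. by case: adm. Qed.

Lemma admissible_size : a <= size w + 2.
Proof. by apply: leq_trans aw _; rewrite leq_add2r alpha_le_size. Qed.
Let as_ := admissible_size.

Let noB k : b <= k -> k + 3 <= a -> k + 2 <= alpha w ->
  nth 0 w k.-1 = 1 -> nth 0 w k = 2 -> False.
Proof.
move=> bk ka kw w1 w2; case: adm => _ _ _ _ H; apply: (H k) => //.
by apply/setBE; [lia|split].
Qed.

Let W_lt k : k < b.-1 -> nth 0 (insert123 w a b) k = nth 0 w k.
Proof. by move=> kb; rewrite nth_insert123 // kb. Qed.
Let W_1 : nth 0 (insert123 w a b) b.-1 = 1.
Proof. by rewrite nth_insert123 // ltnn eqxx. Qed.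
Let W_2 : nth 0 (insert123 w a b) b = 2.
Proof. by rewrite nth_insert123 // eqxx !ifF //; lia. Qed.
Let W_mid k : b < k < a -> nth 0 (insert123 w a b) k = nth 0 w (k - 2).
Proof.
by move=> kb; rewrite nth_insert123 //; repeat case: ifP => ?; try lia.
Qed.
Let W_3 : nth 0 (insert123 w a b) a = 3.
Proof. by rewrite nth_insert123 // eqxx ltnn !ifF //; lia. Qed.
Let W_gt k : a < k -> nth 0 (insert123 w a b) k = nth 0 w (k - 3).
Proof.
by move=> kb; rewrite nth_insert123 //; repeat case: ifP => ?; try lia.
Qed.

(** Before the inserted 3 stand only the new 12 and the first [a - 2 <= alpha w] letters of [w],
    none of them a 3. *)
Lemma alpha_insert123 : alpha (insert123 w a b) = a.
Proof.
apply: alpha_eq => // i ia.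
case: (ltngtP i b.-1) => [ib|ib|->]; rewrite ?W_1 //.
  by rewrite W_lt //; apply: nth_lt_alpha; lia.
case: (ltngtP i b) => [|ib'|->]; rewrite ?W_2 //; first by lia.
by rewrite W_mid; [apply: nth_lt_alpha|]; lia.
Qed.

Lemma setB_insert123 k : 0 < k ->
  setB (insert123 w a b) k <-> next_set (setB w) a b k.
Proof.
move=> k0; rewrite /next_set !setBE // alpha_insert123; split.
  case=> w1 w2 ka.
  case: (ltngtP k b) => [kb|kb|]; last by move=> kb; right; lia.
    have [kb1|kb1] := eqVneq k b.-1; first by rewrite kb1 W_1 in w2.
    by left; rewrite !W_lt in w1 w2; try lia; split; [split|]; lia.
  have [kb1|kb1] := eqVneq k b.+1; first by rewrite kb1 /= W_2 in w1.
  rewrite !W_mid in w1 w2; try lia.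
  (* A 12 between the inserted pair and the inserted 3 comes from a 12 of [w] two places earlier, in
     the range that admissibility keeps free. *)
  exfalso; apply: (@noB (k - 2)); try lia.
  by rewrite -w1; congr nth; lia.
case=> [[[w1 w2 kw] kb]|[-> ab]]; last by split.
by rewrite !W_lt; try lia; split=> //; lia.
Qed.

Lemma yamanouchi3_insert123 n : yamanouchi3 n w ->
  yamanouchi3 n.+1 (insert123 w a b).
Proof.
move=> /yamanouchi3E[sw tw pw]; apply/yamanouchi3E; split.
- move=> x; rewrite !mem_cat inE => /or4P[/mem_take/sw| |/mem_drop/mem_take/sw|] //.
    by rewrite !inE => /orP[]->; rewrite ?orbT.
  by rewrite inE => /orP[/eqP->|/mem_drop/sw].
- by move=> c c0; rewrite count_insert123 // tw //; case: ifP; lia.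
- move=> i; rewrite !count_take_insert123 //=.
  have := pw i; have := pw b.-1; have := pw (i - 2); have := pw (i - 3).
  (* With the prefix counts made opaque, the goal is a case split over linear inequalities. *)
  have [cnt E] : exists cnt, forall c j, count_mem c (take j w) = cnt c j.
    by exists (fun c j => count_mem c (take j w)).
  rewrite !E; clear.
  by repeat case: ifP => ?; lia.
Qed.

Let bound := if nth 0 (insert123 w a b) a.+1 == 3 then a - 2 else a.-1.

(* [b] can be read off the new word as the position of its last [12] ending
   before the leftmost 3, or before the preceding letter when that 3 is
   followed by another one. *)
Lemma insert123_last12 : 0 < count_mem 3 w ->
  [/\ nth 0 (insert123 w a b) b.-1 = 1, nth 0 (insert123 w a b) b = 2, b <= bound
    & forall k, b < k <= bound -> nth 0 (insert123 w a b) k.-1 = 1 ->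
        nth 0 (insert123 w a b) k = 2 -> False].
Proof.
move=> w3; have wa := nth_alpha w3.
rewrite /bound (@W_gt a.+1) // (_ : a.+1 - 3 = a - 2); last by lia.
(* A second 3 right after the inserted one is the letter of [w] at index [a - 2], which forces
   [b <= alpha w <= a - 2]. *)
split=> //; first by case: eqP => [/alpha_le|]; lia.
move=> k /andP[bk kbd] w1 w2.
have ka : k < a by move: kbd; case: ifP; lia.
(* If the next letter is not a 3, then [alpha w] differs from [a - 2], hence is at least [a - 1].
   This puts the 12 of [w] at [k - 2] within reach of [setB w]. *)
have kw : k <= alpha w.
  move: kbd; case: eqP => w2'; first by lia.
  by have [aw2|] := eqVneq (a - 2) (alpha w); [rewrite aw2 in w2'|lia].
have [kb1|kb1] := eqVneq k b.+1; first by rewrite kb1 /= W_2 in w1.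
rewrite !W_mid in w1 w2; try lia.
apply: (@noB (k - 2)); try lia.
by rewrite -w1; congr nth; lia.
Qed.

End InsertWord.

(** The new word determines [a] as its [alpha], then [b] as its last 12 within the bound, and
    finally [w] by deletion. *)
Lemma insert123_inj w1 w2 a1 b1 a2 b2 :
  0 < count_mem 3 w1 -> 0 < count_mem 3 w2 ->
  admissible (alpha w1) (setB w1) a1 b1 ->
  admissible (alpha w2) (setB w2) a2 b2 ->
  insert123 w1 a1 b1 = insert123 w2 a2 b2 -> [/\ w1 = w2, a1 = a2 & b1 = b2].
Proof.
move=> w13 w23 adm1 adm2 E.
have Ea : a1 = a2 by rewrite -(alpha_insert123 adm1) E alpha_insert123.
subst a2.
have [p1 q1 r1 l1] := insert123_last12 adm1 w13.
have [p2 q2 r2 l2] := insert123_last12 adm2 w23.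
rewrite -E in p2 q2 r2 l2.
have Eb : b1 = b2.
  case: (ltngtP b1 b2) => // b12; first by case: (l1 b2); rewrite ?b12.
  by case: (l2 b1); rewrite ?b12.
subst b2; split=> //.
have [b0 ba _ _ _] := adm1.
rewrite -(insert123K b0 ba (admissible_size adm1)) E.
exact: insert123K b0 ba (admissible_size adm2).
Qed.

(** * Every larger word arises from a legal insertion *)

(** Before the leftmost 3 only 1 and 2 occur, and the first letter is 1; without a factor 12 no 2
    can ever appear. *)
Lemma yamanouchi3_no12 n w m : yamanouchi3 n w -> m <= alpha w -> m <= size w ->
  (forall k, 0 < k < m -> nth 0 w k.-1 = 1 -> nth 0 w k = 2 -> False) ->
  count_mem 2 (take m w) = 0.
Proof.
move=> /yamanouchi3E[sw _ pw] mw ms no12.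
have H i : i < m -> nth 0 w i = 1.
  have wi j : j < m -> nth 0 w j \in [:: 1; 2].
    move=> jm; have := nth_lt_alpha (leq_trans jm mw).
    have := mem_nth 0 (leq_trans jm ms); move=> /sw.
    by rewrite !inE => /or3P[]/eqP->.
  elim: i => [|i IH] im; have := wi _ im; rewrite !inE => /orP[/eqP//|/eqP w2].
    by have [+ _] := pw 1; rewrite !count_take_succ // !take0 w2.
  by case: (no12 i.+1) => //; apply: IH; apply: ltnW.
apply/eqP; rewrite -leqn0 leqNgt -has_count; apply/hasPn => x.
move=> /(nthP 0)[i]; rewrite size_takel // => im.
by rewrite nth_take // => <-; rewrite H.
Qed.

Lemma yamanouchi3_insertP n w : 0 < n -> yamanouchi3 n.+1 w ->
  exists w' a b, [/\ yamanouchi3 n w', admissible (alpha w') (setB w') a b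
                   & w = insert123 w' a b].
Proof.
move=> n0 yw; have /yamanouchi3E[sw tw pw] := yw.
move Ea : (alpha w) => a.
have w3 : nth 0 w a = 3 by rewrite -Ea; apply: nth_alpha; rewrite tw.
have as_ : a < size w by case: ltnP => // ?; rewrite nth_default in w3.
have a3 i : i <= a -> count_mem 3 (take i w) = 0.
  move=> ia; apply/eqP; rewrite -leqn0 leqNgt -has_count; apply/hasPn => x.
  move=> /(nthP 0)[j]; rewrite size_takel; last exact: leq_trans ia (ltnW as_).
  by move=> ji; rewrite nth_take // => <-; apply: nth_lt_alpha; rewrite Ea; lia.
pose bound := if nth 0 w a.+1 == 3 then a - 2 else a.-1.
pose is12 k := [&& 0 < k <= bound, nth 0 w k.-1 == 1 & nth 0 w k == 2].
have S c i c0 := @count_take_succ c w i c0.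
have P1 := pw a.+1; have P2 := pw a.+2.
rewrite !S // w3 a3 // in P1; rewrite !S // w3 a3 // in P2.
have a0 : 0 < a by case: (posnP a) P1 => // ->; rewrite take0 /=; lia.
(* Otherwise the prefix ending at the leftmost 3 would contain no 2, or the prefix ending at an
   immediately following 3 would contain at most one. *)
have ex12 : exists k, is12 k.
  apply: contrapT => no.
  have H : count_mem 2 (take bound.+1 w) = 0.
    apply: (@yamanouchi3_no12 n.+1) => //.
    - by rewrite Ea /bound; case: ifP; lia.
    - by rewrite /bound; case: ifP; lia.
    - move=> k kb w1 w2; apply: no; exists k.
      by rewrite /is12 w1 w2 !eqxx andbT; lia.
  move: H P1 P2; rewrite /bound; case: (nth 0 w a.+1 =P 3) => [->|_].
    (* The case [a = 1] is separate because [a - 2] is truncated to 0. *)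
    case: (a) a0 => [|[|i]] // _ H _; first by rewrite H /=; lia.
    move: H; rewrite subSS subSS subn0 (S 2 i.+1) // => ->.
    by case: (_ == 2); rewrite /=; lia.
  by rewrite prednK // => -> /=; lia.
have ub k : is12 k -> k <= bound by case/and3P; lia.
case: (ex_maxnP ex12 ub) => b /and3P[/andP[b0 bb] /eqP w1 /eqP w2] bmax.
have ba : b < a by move: bb; rewrite /bound; case: ifP; lia.
set w' := delete123 w a b.
have E : insert123 w' a b = w by exact: delete123K.
have sw' : a <= size w' + 2 by rewrite size_delete123 //; lia.
have tw' c : 0 < c -> count_mem c w' = if c <= 3 then n else 0.
  by move=> c0; have := tw c c0; rewrite -E count_insert123 //; case: ifP; lia.
have w'3 : 0 < count_mem 3 w' by rewrite tw'.
have w'lt k : k < b.-1 -> nth 0 w' k = nth 0 w k.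
  by move=> kb; rewrite nth_delete123 // kb.
have w'mid k : b.-1 <= k -> k < a - 2 -> nth 0 w' k = nth 0 w (k + 2).
  by move=> kb ka; rewrite nth_delete123 // ka ifF //; lia.
have w'a : nth 0 w' (a - 2) = nth 0 w a.+1.
  by rewrite nth_delete123 // !ifF; [congr nth| |]; lia.
have aw' : a - 2 <= alpha w'.
  apply: alpha_ge => // i ia; case: (ltnP i b.-1) => ib.
    by rewrite w'lt //; apply: nth_lt_alpha; rewrite Ea; lia.
  by rewrite w'mid //; apply: nth_lt_alpha; rewrite Ea; lia.
(* This sharper bound is what allows [b = a - 1], a value possible only when the leftmost 3 is not
   followed by another 3. *)
have aw'' : nth 0 w a.+1 != 3 -> a.-1 <= alpha w'.
  rewrite -w'a => w'a3; have : alpha w' != a - 2.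
    by apply: contraNneq w'a3 => <-; rewrite nth_alpha.
  by lia.
exists w', a, b; split=> //.
- apply/yamanouchi3E; split=> //.
    move=> x /mem_delete123 /sw //.
  move=> i.
  (* A prefix of [w'] of length [i] is matched with one of [w] of length [i], [i + 2] or [i + 3]. In
     the middle case the extra 2 weakens the comparison of 2's and 3's, but [a3] shows that no 3
     occurs there. *)
  have := pw i; have := pw (i + 2); have := pw (i + 3).
  have := a3 (i + 2); rewrite -E !count_take_insert123 //=.
  have -> : i + 2 - 2 = i by lia.
  have -> : i + 3 - 3 = i by lia.
  have [cnt F] : exists cnt, forall c j, count_mem c (take j w') = cnt c j.
    by exists (fun c j => count_mem c (take j w')).
  rewrite !F; clear - ba b0; repeat case: ifP => ?; lia.
- split=> //; first by lia.
    by move: bb; rewrite /bound; case: eqP => [|/eqP/aw'']; lia.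
  move=> k bk ka /setBE[|v1 v2 kw]; first by lia.
  rewrite !w'mid in v1 v2; try lia.
  (* A 12 of [w'] in the forbidden range would be a 12 of [w] at [k + 2], beyond the maximal choice
     [b]. *)
  have : k + 2 <= b.
    apply: bmax; rewrite /is12 v2 eqxx (_ : (k + 2).-1 = k.-1 + 2); last by lia.
    rewrite v1 eqxx !andbT; apply/andP; split; first by lia.
    rewrite /bound; case: eqP => w3'; last by lia.
    by rewrite w3' in w'a; have := alpha_le w'a; lia.
  by lia.
Qed.

(** * Relabelling permutations to make room for two values *)

(** For [b < a] this is the increasing relabelling that skips [b] and [a]: when [a <= x.+1], the
    first shift has already taken place. *)
Definition shift_up (a b x : nat) : nat := x + (b <= x) + (a <= x.+1).

Definition shift_down (a b y : nat) : nat := y - (b < y) - (a < y).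

Definition prepend (q : seq nat) (a b : nat) : seq nat :=
  a :: b :: map (shift_up a b) q.

Lemma letter_prepend q a b i : 1 <= b -> b < a -> 0 < i ->
  letter (prepend q a b) i.+2 = shift_up a b (letter q i).
Proof.
case: i => // i b0 ba _; rewrite /letter /=.
case: (ltnP i (size q)) => iq; first by rewrite (nth_map 0).
(* Past the end both sides are the default 0, which [shift_up] fixes. *)
by rewrite !nth_default ?size_map // /shift_up; lia.
Qed.

Lemma letter_mem p i : 0 < i <= size p -> letter p i \in p.
Proof. by case: i => // i ip; apply: mem_nth. Qed.

Lemma letterP p x : x \in p -> exists2 i, 0 < i <= size p & letter p i = x.
Proof. by move=> /(nthP 0)[i ip <-]; exists i.+1. Qed.

Lemma letter_inj p i j : uniq p -> 0 < i <= size p -> 0 < j <= size p ->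
  letter p i = letter p j -> i = j.
Proof.
case: i j => [|i] // [|j] // up ip jp /eqP.
by rewrite /letter /= nth_uniq // => /eqP ->.
Qed.

Lemma is_permutationE m p : is_permutation m p <->
  [/\ uniq p, size p = m & forall x, x \in p -> 1 <= x <= m].
Proof.
split.
  move=> /[dup] /perm_uniq; rewrite iota_uniq => up.
  move=> /[dup] /perm_size; rewrite size_iota => sp /perm_mem mp.
  by split=> // x; rewrite mp mem_iota; lia.
move=> [up sp mp]; apply: uniq_perm => //; first exact: iota_uniq.
have sub : {subset p <= iota 1 m} by move=> x /mp; rewrite mem_iota; lia.
by apply: (uniq_min_size up sub _).2; rewrite size_iota sp.
Qed.

Lemma mem_permutation m p x : is_permutation m p -> 1 <= x <= m ->
  exists2 i, 0 < i <= size p & letter p i = x.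
Proof.
by move=> /perm_mem mp xm; apply: letterP; rewrite mp mem_iota; lia.
Qed.

Lemma is_permutation_prepend m q a b :
  1 <= b -> b < a -> a <= m.+2 -> is_permutation m q ->
  is_permutation m.+2 (prepend q a b).
Proof.
move=> b0 ba am /is_permutationE[uq sq mq]; apply/is_permutationE; split.
- rewrite /= inE negb_or; apply/and3P; split.
  + apply/andP; split; first by lia.
    by apply/mapP => -[x /mq]; rewrite /shift_up; lia.
  + by apply/mapP => -[x /mq]; rewrite /shift_up; lia.
  + by rewrite map_inj_uniq // => x y; rewrite /shift_up; lia.
- by rewrite /= size_map sq.
- move=> x; rewrite !inE => /or3P[/eqP->|/eqP->|/mapP[y /mq + ->]];
    rewrite /shift_up; lia.
Qed.

Lemma is_permutation_prependP m p : is_permutation m.+2 p ->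
  letter p 2 < letter p 1 ->
  exists q, is_permutation m q /\ p = prepend q (letter p 1) (letter p 2).
Proof.
move=> /is_permutationE[]; case: p => [|a [|b s]] // up [ss] mp.
rewrite /letter /= => ba; exists (map (shift_down a b) s).
move: up; rewrite /= inE negb_or => /and3P[/andP[_ as_] bs us].
have sK x : x \in s -> shift_up a b (shift_down a b x) = x.
  move=> xs; have xa : x != a by apply: contraNneq as_ => <-.
  have xb : x != b by apply: contraNneq bs => <-.
  rewrite /shift_up /shift_down; lia.
have sE : map (shift_up a b) (map (shift_down a b) s) = s.
  by rewrite -map_comp map_id_in // => x /sK.
split; last by rewrite /prepend sE.
apply/is_permutationE; split.
- by rewrite -sE in us; move: us => /map_uniq.
- by rewrite size_map.
- move=> y /mapP[x xs ->].
  have xa : x != a by apply: contraNneq as_ => <-.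
  have xb : x != b by apply: contraNneq bs => <-.
  have := mp a; have := mp b; have := mp x.
  rewrite !inE xs !eqxx !orbT /shift_down => /(_ isT) ? /(_ isT) ? /(_ isT); lia.
Qed.

(** Descend from the larger value: its predecessor either stands left of it, giving the pair, or
    stands right of [i] and takes its place. This turns the 23 of a 4123 pattern into consecutive
    values as in [setA]. *)
Lemma consecutive_ascent m q x y i j : is_permutation m q ->
  0 < i -> i < j -> j <= size q ->
  letter q i = x -> letter q j = y -> x < y ->
  exists k i' j', [/\ x <= k, k < y, 0 < i', i' < j' & j' <= size q] /\
                  (letter q i' = k /\ letter q j' = k.+1).
Proof.
move=> pq i0; have [uq sq mq] := (is_permutationE _ _).1 pq.
elim: y j => // y IH j ij jq xi yj xy.
have [yx|yx] := eqVneq x y.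
  by exists x, i, j; split; [split|split]; rewrite // ?yj; lia.
have yin : 1 <= y <= m.
  have := mq _ (letter_mem (_ : 0 < j <= size q)); rewrite yj => /(_ _); lia.
have [l lq ly] := mem_permutation pq yin.
have [lj|jl] := ltnP l j.
  by exists y, l, j; split; [split|split]; rewrite // ?yj; lia.
have il : i < l by lia.
have lq' : l <= size q by case/andP: lq.
have xy' : x < y by lia.
have [k [i' [j' [[? ? ? ? ?] ?]]]] := IH l il lq' xi ly xy'.
by exists k, i', j'; split; [split|]; lia.
Qed.

Lemma setAE q k : 0 < k -> setA q k <->
  (exists i j, [/\ 0 < i, i < j, j <= size q, letter q i = k
      & letter q j = k.+1]) /\ k + 2 <= letter q 1.
Proof.
by move=> k0; split; [case=> // /= k00; rewrite k00 in k0|right].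
Qed.

(** * Effect of prepending two values to a permutation *)

Section Prepend.
Variables (q : seq nat) (a b : nat).
Hypothesis b0 : 1 <= b.
Hypothesis ba : b < a.

Let p := prepend q a b.
Let f := shift_up a b.

Let f_lt x y : (f x < f y) = (x < y).
Proof. by rewrite /f /shift_up; lia. Qed.

Let size_p : size p = (size q).+2.
Proof. by rewrite /= size_map. Qed.

Let pS i : 0 < i -> letter p i.+2 = f (letter q i).
Proof. exact: letter_prepend. Qed.

Let p1 : letter p 1 = a. Proof. by []. Qed.
Let p2 : letter p 2 = b. Proof. by []. Qed.

Lemma down_up_prepend : b <= letter q 1 -> down_up q -> down_up p.
Proof.
move=> bq duq [|[|[|i]]] // _; rewrite size_p => ip.
  by rewrite p2 /= (@pS 1) // /f /shift_up; lia.
by rewrite /= negbK !pS // !f_lt; apply: duq; lia.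
Qed.

Lemma down_up_prependV : 0 < size q -> down_up p -> b <= letter q 1 /\ down_up q.
Proof.
move=> q0 dup; split.
  have := dup 2 isT; rewrite size_p p2 (@pS 1) //= => /(_ _).
  by rewrite /f /shift_up; lia.
move=> [|i] // _ iq; have := dup i.+3 isT; rewrite size_p => /(_ iq).
by rewrite /= negbK !pS // !f_lt.
Qed.

Lemma avoids4123_prependV : avoids4123 p -> avoids4123 q.
Proof.
move=> ap [i1 [i2 [i3 [i4 [[? ? ? ? ?] [? ? ?]]]]]]; apply: ap.
exists i1.+2, i2.+2, i3.+2, i4.+2; rewrite size_p.
by split; split=> //; rewrite ?pS ?f_lt //; lia.
Qed.

Variable m : nat.
Hypothesis m0 : 0 < m.
Hypothesis pq : is_permutation m q.

Let sq : size q = m. Proof. by case/is_permutationE: pq. Qed.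
Let uq : uniq q. Proof. by case/is_permutationE: pq. Qed.

Let neq1 i : 1 < i <= size q -> letter q i != letter q 1.
Proof.
move=> iq; apply/eqP => E.
by have := letter_inj uq (_ : 0 < i <= size q) (_ : 0 < 1 <= size q) E; lia.
Qed.

(** If [a] exceeded [letter q 1 + 2], then [a], [b], the third letter and its successor value would
    form 4123. An element of [setA q] in the forbidden range likewise completes [a], [b] to a
    4123. *)
Lemma admissible_prependV : a <= m.+2 -> down_up p -> avoids4123 p ->
  admissible (letter q 1) (setA q) a b.
Proof.
move=> am dup ap; have [|bq duq] := down_up_prependV _ dup; first by rewrite sq.
split=> //.
  case: leqP => // aq; case: ap.
  have pp : is_permutation m.+2 p by exact: is_permutation_prepend.
  have [|j jp pj] := @mem_permutation _ _ (letter q 1).+2 pp; first by lia.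
  have p3 : letter p 3 = (letter q 1).+1 by rewrite (@pS 1) // /f /shift_up; lia.
  have j3 : 3 < j.
    case: j jp pj => [|[|[|[|j]]]] // _; rewrite ?p1 ?p2 ?p3; lia.
  by exists 1, 2, 3, j; split; split; rewrite // ?pj ?p1 ?p2 ?p3; lia.
move=> k bk ka /setAE[|[i [j [i0 ij jq qi qj]] kq]]; first by lia.
apply: ap; exists 1, 2, i.+2, j.+2; rewrite size_p.
rewrite p1 p2 !pS ?qi ?qj; try lia.
by rewrite /f /shift_up; split; split=> //; lia.
Qed.

Hypothesis adm : admissible (letter q 1) (setA q) a b.

Let aq : a <= letter q 1 + 2. Proof. by case: adm. Qed.
Let bq : b <= letter q 1. Proof. by case: adm. Qed.

Lemma admissible_le : a <= m.+2.
Proof.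
have [_ _ mq] := (is_permutationE _ _).1 pq.
have := mq _ (letter_mem (_ : 0 < 1 <= size q)); rewrite sq => /(_ m0); lia.
Qed.

(** A pattern using both new values yields an element of [setA q] excluded by admissibility. In a
    pattern using just one, that value plays the 4 and can be replaced by the first letter of
    [q]. *)
Lemma avoids4123_prepend : avoids4123 q -> avoids4123 p.
Proof.
move=> av [i1 [i2 [i3 [i4 [[]]]]]]; rewrite size_p.
case: i1 => [|[|[|i1]]] // _; case: i2 => [|[|[|i2]]] //; case: i3 => [|[|[|i3]]] //;
  case: i4 => [|[|[|i4]]] //; rewrite ?ltnn // => i12 i23 i34 i4q [];
  rewrite ?p1 ?p2 !pS // ?f_lt => h1 h2 h3.
- have [k [i [j [[? ? ? ? ?] [qi qj]]]]] := consecutive_ascent pq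
    (isT : 0 < i3.+1) (i34 : i3.+1 < i4.+1) (i4q : i4.+1 <= size q)
    erefl erefl h2.
  have bk : b <= k by move: h1; rewrite /f /shift_up; lia.
  have ka : k + 3 <= a by move: h3; rewrite /f /shift_up; lia.
  case: adm => _ _ _ _ /(_ k bk ka); case; apply/setAE; first by lia.
  split; first by exists i, j.
  (* The value [k.+1] stands after the first letter of [q], so it differs from it and
     [k + 2 <= letter q 1] follows. *)
  have := @neq1 j; rewrite qj => /(_ _).
  by move: h3; rewrite /f /shift_up; lia.
- have i4n := @neq1 i4.+1.
  apply: av; exists 1, i2.+1, i3.+1, i4.+1.
  have i4q' : letter q i4.+1 < letter q 1.
    by move: h3; rewrite /f /shift_up; lia.
  have i2n : i2 != 0.
    apply/eqP => i20; move: h1 h2; rewrite i20; lia.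
  by split; split=> //; lia.
- have i4q' : letter q i4.+1 < letter q 1.
    by move: h3; rewrite /f /shift_up; lia.
  apply: av; exists 1, i2.+1, i3.+1, i4.+1.
  have i2n : i2 != 0.
    apply/eqP => i20; move: h1 h2; rewrite i20; lia.
  by split; split=> //; lia.
- apply: av; exists i1.+1, i2.+1, i3.+1, i4.+1.
  by split; split=> //; lia.
Qed.

Lemma setA_prepend k : 0 < k -> setA p k <-> next_set (setA q) a b k.
Proof.
move=> k0; rewrite /next_set !setAE //; split.
  move=> [[i [j []]]]; rewrite size_p p1.
  case: i => [|[|[|i]]] // _; case: j => [|[|[|j]]] //; rewrite ?ltnn //.
  - by rewrite p1 => _ _ <-; lia.
  - by rewrite p1 => _ _ <-; lia.
  - by rewrite p2 => _ _ <- _; right; lia.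
  rewrite !pS // => ij jq fi fj ka.
  have [kb|bk] := ltnP k b.
    left; split; last by move: fj; rewrite /f /shift_up; lia.
    split; last by move: fj; rewrite /f /shift_up; lia.
    exists i.+1, j.+1; split=> //; first by move: fi; rewrite /f /shift_up; lia.
    by move: fj; rewrite /f /shift_up; lia.
  (* Values strictly between [b] and [a] come from values one lower, so the pair would put [k.-1] in
     [setA q], inside the forbidden range. *)
  have qi : letter q i.+1 = k.-1 by move: fi; rewrite /f /shift_up; lia.
  have qj : letter q j.+1 = k by move: fj; rewrite /f /shift_up; lia.
  have kb : k != b by apply/eqP => kb; move: fi; rewrite /f /shift_up; lia.
  case: adm => _ _ _ _ /(_ k.-1); case; try lia.
  apply/setAE; first by lia.
  split; first by exists i.+1, j.+1; split=> //; rewrite qj; lia.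
  by have := @neq1 j.+1; rewrite qj => /(_ _); lia.
case=> [[[[i [j [i0 ij jq qi qj]]] kq] kb]|[-> ab]]; split=> //.
- exists i.+2, j.+2; rewrite size_p !pS ?qi ?qj; try lia.
  by rewrite /f /shift_up; split; lia.
- by rewrite p1; lia.
(* As [b + 2 <= a], the value [b.+1] is neither of the two new ones and so stands to the right of
   [b]. *)
have pp := is_permutation_prepend b0 ba admissible_le pq.
have [|j jp pj] := @mem_permutation _ _ b.+1 pp; first by have := admissible_le; lia.
exists 2, j; split=> //; last by case/andP: jp.
by case: j jp pj => [|[|[|j]]] //; rewrite ?p1 ?p2; lia.
Qed.

End Prepend.

(** * Decomposing permutations, and the case of size one *)

Definition strip (p : seq nat) : seq nat :=
  map (shift_down (letter p 1) (letter p 2)) (drop 2 p).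

Lemma prependK q a b : 1 <= b -> b < a -> strip (prepend q a b) = q.
Proof.
move=> b0 ba; rewrite /strip /= drop0 -map_comp map_id_in // => x _ /=.
by rewrite /shift_up /shift_down /letter /=; lia.
Qed.

Lemma DU4123_prepend m q a b : 0 < m -> DU4123 m q ->
  admissible (letter q 1) (setA q) a b -> DU4123 m.+2 (prepend q a b).
Proof.
move=> m0 [pq duq avq] adm; have [b0 ba _ bq _] := adm; split.
- exact: is_permutation_prepend b0 ba (admissible_le b0 ba m0 pq adm) pq.
- exact: down_up_prepend b0 ba bq duq.
- exact (avoids4123_prepend b0 ba m0 pq adm avq).
Qed.

Lemma DU4123_prependP m p : 0 < m -> DU4123 m.+2 p -> exists q a b,
  [/\ DU4123 m q, admissible (letter q 1) (setA q) a b & p = prepend q a b].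
Proof.
move=> m0 [pp dup avp]; have [up sp mp] := (is_permutationE _ _).1 pp.
have ba : letter p 2 < letter p 1 by apply: (dup 1); rewrite ?sp.
have [q [pq Ep]] := is_permutation_prependP pp ba.
have /mp /andP[_ am] : letter p 1 \in p by apply: letter_mem; rewrite sp.
have /mp /andP[b0 _] : letter p 2 \in p by apply: letter_mem; rewrite sp.
move: (letter p 1) (letter p 2) ba am b0 Ep => a b ba am b0 Ep; subst p.
exists q, a, b; split=> //; last exact (admissible_prependV b0 ba m0 pq am dup avp).
have q0 : 0 < size q by have [_ -> _] := (is_permutationE _ _).1 pq.
split=> //; first by have [] := down_up_prependV b0 ba q0 dup.
exact (avoids4123_prependV b0 ba avp).
Qed.

Lemma DU4123_2 p : DU4123 2 p <-> p = [:: 2; 1].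
Proof.
split=> [[/is_permutationE[]]|->].
  case: p => [|x [|y []]] // /andP[xy _] _ mp dup _.
  have := dup 1 isT isT; rewrite /letter /= => yx.
  have := mp x; have := mp y; rewrite !inE !eqxx orbT => /(_ isT) ? /(_ isT) ?.
  by congr [:: _; _]; lia.
split=> //; first by move=> [|[|[]]].
move=> [i1 [i2 [i3 [i4 [[? ? ? ? +] _]]]]]; rewrite (_ : size [:: 2; 1] = 2) //; lia.
Qed.

Lemma yamanouchi3_1 w : yamanouchi3 1 w <-> w = [:: 1; 2; 3].
Proof.
split=> [/yamanouchi3E[sw tw pw]|->].
  have sz : size w = count_mem 1 w + count_mem 2 w + count_mem 3 w.
    elim: w sw {tw pw} => //= x w IH sw.
    have /IH -> : {subset w <= [:: 1; 2; 3]}.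
      by move=> y yw; apply: sw; rewrite inE yw orbT.
    have := sw x; rewrite !inE eqxx => /(_ isT) /or3P[]/eqP-> /=; lia.
  rewrite !tw //= in sz; case: w sz sw tw pw => [|x [|y [|z []]]] // _ sw tw pw.
  have := sw x; have := sw y; have := sw z; rewrite !inE !eqxx !orbT.
  move=> /(_ isT) hz /(_ isT) hy /(_ isT) hx.
  have := pw 1; have := pw 2; have := tw 1 isT; have := tw 2 isT.
  (* Of the 27 candidate words, the counts of 1 and 2 and the prefixes of length 1 and 2 leave only
     123. *)
  by case/or3P: hx => /eqP->; case/or3P: hy => /eqP->;
     case/or3P: hz => /eqP-> //=; lia.
apply/yamanouchi3E; split=> //; first by case=> [|[|[|[|c]]]].
by case=> [|[|[|[|i]]]].
Qed.

Theorem theorem2p5 (n : nat) (hn : 1 <= n) :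
  exists phi : seq nat -> seq nat,
    set_bij (DU4123 (2 * n)) (yamanouchi3 n) phi /\
    (forall p : seq nat, DU4123 (2 * n) p ->
       letter p 1 = alpha (phi p) /\ setA p = setB (phi p)).
Proof.
elim: n hn => // -[_ _|n IH _].
  exists (fun=> [:: 1; 2; 3]); split; first split.
  - by move=> p _; apply/yamanouchi3_1.
  - by move=> p q; rewrite !inE => /DU4123_2-> /DU4123_2->.
  - move=> w /yamanouchi3_1->; exists [:: 2; 1] => //; exact/DU4123_2.
  move=> p /DU4123_2->; split=> //; apply/seteqP; split=> k.
    by case=> [->|[_]]; [left|rewrite /letter /=; case: k => [|k]; [left|lia]].
  by case=> [->|[/andP[k0 _] _ _]]; [left|rewrite /alpha /=; lia].
have {IH} [phi [[phiF phiI phiS] phiE]] := IH isT.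
set m := 2 * n.+1 in phiF phiI phiS phiE.
have m0 : 0 < m by rewrite /m; lia.
have -> : 2 * n.+2 = m.+2 by rewrite /m; lia.
have tw w : yamanouchi3 n.+1 w -> 0 < count_mem 3 w.
  by move=> /yamanouchi3E[_ tw _]; rewrite tw.
pose psi p := insert123 (phi (strip p)) (letter p 1) (letter p 2).
have psiE q a b : admissible (letter q 1) (setA q) a b ->
    psi (prepend q a b) = insert123 (phi q) a b.
  by case=> b0 ba _ _ _; rewrite /psi prependK.
(* Legality depends only on the two statistics, which [phi] preserves, so both sides admit the same
   pairs. *)
have admE q a b : DU4123 m q -> admissible (letter q 1) (setA q) a b <->
    admissible (alpha (phi q)) (setB (phi q)) a b.
  by move=> /phiE[-> ->].
exists psi; split; first split.
- move=> p /(DU4123_prependP m0)[q [a [b [dq adm ->]]]].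
  rewrite psiE //; apply: yamanouchi3_insert123; first exact/admE.
  exact: phiF.
- move=> p1 p2; rewrite !inE.
  move=> /(DU4123_prependP m0)[q1 [a1 [b1 [dq1 adm1 ->]]]].
  move=> /(DU4123_prependP m0)[q2 [a2 [b2 [dq2 adm2 ->]]]].
  rewrite !psiE // => E.
  have [Eq -> ->] := insert123_inj (tw _ (phiF _ dq1)) (tw _ (phiF _ dq2))
    ((admE _ _ _ dq1).1 adm1) ((admE _ _ _ dq2).1 adm2) E.
  by rewrite (phiI q1 q2) ?inE.
- move=> w /(yamanouchi3_insertP (ltn0Sn n))[w' [a [b [yw' + ->]]]].
  have [q dq <-] := phiS _ yw'.
  move=> /(admE _ _ _ dq) adm; exists (prepend q a b); last by rewrite psiE.
  exact: DU4123_prepend.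
move=> p /(DU4123_prependP m0)[q [a [b [dq adm ->]]]].
have [pq _ _] := dq; have [b0 ba _ _ _] := adm.
have adm' := (admE _ _ _ dq).1 adm.
rewrite psiE // alpha_insert123 //; split=> //.
(* The element 0 is in both sets by definition; the positive ones obey the same [next_set] rule. *)
apply/seteqP; split=> -[_|k]; try by left.
  move=> /(setA_prepend b0 ba m0 pq adm (ltn0Sn k)).
  by rewrite /next_set (phiE _ dq).2 => /(setB_insert123 adm' (ltn0Sn k)).
move=> /(setB_insert123 adm' (ltn0Sn k)).
by rewrite /next_set -(phiE _ dq).2 => /(setA_prepend b0 ba m0 pq adm (ltn0Sn k)).
Qed.
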